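(* Let $(a_i)_{i=1}^n$ be a sequence of positive integers. Then: (1) $\operatorname{TC}\big(\bigvee_{i=1}^n S^{a_i}, *\big)=2$, where $*$ is a single point of $\bigvee_{i=1}^n S^{a_i}$; and (2) for $1<m<n$, $\operatorname{TC}\big(\bigvee_{i=1}^n S^{a_i},\ \bigvee_{j=1}^m S^{a_j}\big)=3$.
   Context: For a continuous map (fibration) $f:E\to B$, the Schwarz genus $\operatorname{genus}(f)$ is the smallest $k$ such that $B$ has an open cover $U_1,\dots,U_k$ for which each $U_i$ admits a continuous section $s_i:U_i\to E$ of $f$. For a space $X$ and $Y\subseteq X$, let $P_{X\times Y}$ be the space of continuous paths $\gamma:[0,1]\to X$ with $\gamma(1)\in Y$, and let $\pi:P_{X\times Y}\to X\times Y$, $\pi(\gamma)=(\gamma(0),\gamma(1))$. The relative topological complexity of the pair is $\operatorname{TC}(X,Y)=\operatorname{genus}(\pi)$ (unreduced convention). $\bigvee_{i=1}^n S^{a_i}$ is the wedge of the spheres $S^{a_1},\dots,S^{a_n}$ at a common point, and $\bigvee_{j=1}^m S^{a_j}$ is its subspace consisting of the first $m$ spheres. *)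

(* Defs.v *)
From mathcomp Require Import all_boot all_order all_algebra.
From mathcomp Require Import all_classical all_reals all_analysis.
From mathcomp Require Import homotopy.
Import Order.TTheory GRing.Theory Num.Theory.
Import numFieldNormedType.Exports.

Set Implicit Arguments.
Unset Strict Implicit.
Unset Printing Implicit Defensive.

Local Open Scope classical_set_scope.
Local Open Scope ring_scope.

Definition has_sectional_cover (E B : topologicalType) (f : E -> B) (k : nat) :=
  exists U : 'I_k -> set B,
    [/\ forall i, open (U i),
        \bigcup_i U i = [set: B] &
        forall i, exists s : U i -> E,
          continuous s /\ forall x : U i, f (s x) = set_val x].

(* Unreduced: the genus is the number of open sets in a smallest cover. *)
Definition genus (E B : topologicalType) (f : E -> B) : \bar nat :=
  if pselect (exists k, `[< has_sectional_cover f k >]) is left ex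
  then (ex_minn ex)%:E else +oo%E.

Lemma genusP (E B : topologicalType) (f : E -> B) (k : nat) :
  genus f = k%:E <->
  has_sectional_cover f k /\
  (forall l, has_sectional_cover f l -> (k <= l)%N).
Proof.
rewrite /genus; case: pselect => [ex|nex]; split=> //.
- case: ex_minnP => m /asboolP fm mmin [<-]; split=> // l fl.
  by apply: mmin; apply/asboolP.
- case=> fk kmin; congr EFin; case: ex_minnP => m /asboolP fm mmin.
  by apply/eqP; rewrite eqn_leq kmin// andbT mmin//; apply/asboolP.
- by case=> fk _; case: nex; exists k; apply/asboolP.
Qed.

Definition unit_interval (R : realType) : set R := `[0, 1].
Arguments unit_interval : clear implicits.

Lemma unit_interval0_subproof (R : realType) : (0 : R) \in unit_interval R.
Proof. by rewrite inE /unit_interval /= in_itv /= lexx ler01. Qed.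

Lemma unit_interval1_subproof (R : realType) : (1 : R) \in unit_interval R.
Proof. by rewrite inE /unit_interval /= in_itv /= lexx ler01. Qed.

Definition itv_zero (R : realType) : unit_interval R :=
  exist _ 0 (unit_interval0_subproof R).
Definition itv_one (R : realType) : unit_interval R :=
  exist _ 1 (unit_interval1_subproof R).

Section relative_topological_complexity.
Context (R : realType) (X : topologicalType) (Y : set X).

(* The coercion of this set to a type carries the subspace topology inherited
   from the compact-open topology. *)
Definition path_space : set {compact-open, unit_interval R -> X} :=
  [set g | continuous (g : unit_interval R -> X) /\ Y (g (itv_one R))].

Lemma path_space_end (g : path_space) : set_val g (itv_one R) \in Y.
Proof. by apply/mem_set; have [] := set_mem (valP g). Qed.

Definition path_ends (g : path_space) : X * Y :=
  (set_val g (itv_zero R), exist _ (set_val g (itv_one R)) (path_space_end g)).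

Lemma path_eval_continuous (t : unit_interval R) :
  continuous (fun g : path_space => set_val g t).
Proof.
apply/continuousP => O oO.
exists [set g : {compact-open, unit_interval R -> X} | g @` [set t] `<=` O].
  by apply: compact_open_open => //; exact: compact_set1.
by apply/seteqP; split=> g /=; [apply; exists t|move=> gO _ [_ -> <-]].
Qed.

Lemma path_ends_continuous : continuous path_ends.
Proof.
have c2 : continuous (fun g => (path_ends g).2).
  apply/continuousP => _ [V oV <-].
  by have /continuousP := @path_eval_continuous (itv_one R); exact.
move=> g S [[P Q] [/= Pg Qg] PQS]; rewrite nbhs_simpl /=.
have nP : nbhs g [set h | P (path_ends h).1].
  exact: (@path_eval_continuous (itv_zero R) g P Pg).
have nQ : nbhs g [set h | Q (path_ends h).2] by exact: (c2 g Q Qg).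
by apply: filterS2 nP nQ => h Ph Qh; exact: (PQS (path_ends h)).
Qed.

Definition TC : \bar nat := genus path_ends.

End relative_topological_complexity.
Arguments path_space R {X} Y.
Arguments path_ends R {X} Y.

Definition sphere (R : realType) (d : nat) : set 'rV[R]_d.+1 :=
  [set x | \sum_(i < d.+1) x 0 i ^+ 2 = 1].
Arguments sphere : clear implicits.

Lemma sphere_pt_subproof (R : realType) (d : nat) :
  delta_mx 0 0 \in sphere R d.
Proof.
rewrite inE /sphere /= big_ord_recl mxE !eqxx expr1n big1 ?addr0// => i _.
by rewrite mxE expr0n.
Qed.

Definition sphere_pt (R : realType) (d : nat) : sphere R d :=
  exist _ (delta_mx 0 0) (sphere_pt_subproof R d).

Definition sphere_wedge (R : realType) (n : nat) (a : 'I_n -> nat) :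
    topologicalType :=
  wedge (fun i : 'I_n => sphere_pt R (a i)).

Definition sphere_subwedge (R : realType) (n : nat) (a : 'I_n -> nat)
    (m : nat) : set (sphere_wedge R a) :=
  \bigcup_(i in [set i : 'I_n | (i < m)%N])
    range (wedge_lift (fun i : 'I_n => sphere_pt R (a i)) (i := i)).
Arguments sphere_subwedge R {n} a m.

(* Main.v *)
Require Import Defs.
From mathcomp Require Import all_boot all_order all_algebra.
From mathcomp Require Import all_classical all_reals all_analysis.
From mathcomp Require Import homotopy lra.
Import Order.TTheory GRing.Theory Num.Theory.
Import numFieldNormedType.Exports.
Set Implicit Arguments.
Unset Strict Implicit.
Unset Printing Implicit Defensive.
Local Open Scope classical_set_scope.
Local Open Scope ring_scope.

(** Both upper bounds come from one pair of deformations of the wedge [W]. The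
height of a point of a sphere is its first coordinate; the base point has
height 1. Pulling every sphere straight towards the base point, more and more
weakly near the antipode, contracts the part of height at least -1/3 to the
base point. Pulling first towards a point of the equator, with a weight that
vanishes on the upper half, and then towards the base point gives a second
deformation, which contracts the part of height at most -1/6; the equator is
where positive dimension is used.
A path from [x] to [y] runs along a deformation of [x] to the base point and
returns along a deformation of [y] (lemma [motion_planner]). When [y] is a
fixed point, only the choice for [x] varies, so two open sets suffice. In
general there are four choices, and the two mixed ones share an open set,
since they are made where -1/4 separates the heights of [x] and [y], in one
order or in the other.

The lower bounds come from Brouwer's fixed point theorem, which replaces the
cup products of the cohomological argument. Let [b] and [c] be spheres of the
wedge, [c] inside the subspace and [b] outside. Over an open set with a
section, the paths of the section, retracted onto [b], contract the first
projection of [b * c], and retracted onto [c] they contract the second one. So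
a cover by two sets would give open sets [V] and [W] covering [b * c], with
the first projection contractible over [V] and the second over [W]. This is
impossible (lemma [no_cover_contracting_projections]): shrink [V] and [W] to
closed sets that still cover and extend the two contracted projections to maps
[f] and [g] from the whole vector space that contains [b * c] to the spheres
[b] and [c]. A fixed point [(u, v)] of [(- f, - g)] lies on [b * c], and
there either [f] is the first projection or [g] is the second one, so that
[u = - u] or [v = - v]. With [W] empty this says that a sphere is not
contractible, which is the lower bound for a point.

Brouwer's theorem is proved on a cube, from a labelling lemma for grids
(lemma [kuhn]) and compactness. The labelling lemma is a cup product
computation modulo 2. *)

(** * Counting the jumps of labels on a grid *)

Lemma addF2 (x : 'F_2) : x + x = 0.
Proof. by apply: addrr_pchar2; exact: pchar_Fp. Qed.

(** Modulo 2, the contributions of [(s, t)] and [(t, s)] cancel. *)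
Lemma sum_pairsF2 n (D : {set 'I_n}) (G : 'I_n -> 'I_n -> 'F_2) :
  (forall s t, G s t = G t s) -> \sum_(s in D) \sum_(t in D :\ s) G s t = 0.
Proof.
move=> Gsym.
rewrite (eq_bigr (fun s : 'I_n => \sum_(t in D | (s < t)%N) G s t +
    \sum_(t in D | (t < s)%N) G s t)); last first.
  move=> s _; rewrite (bigID (fun t : 'I_n => (s < t)%N)) /=.
  congr (_ + _); apply: eq_bigl => t; rewrite !inE.
    by rewrite -val_eqE /=; case: ltngtP => //=; rewrite ?andbT ?andbF.
  by rewrite -val_eqE /=; case: ltngtP => //=; rewrite ?andbT ?andbF.
rewrite big_split /= [X in _ + X](_ : _ =
    \sum_(s in D) \sum_(t in D | (s < t)%N) G s t) ?addF2//.
rewrite (exchange_big_dep (mem D)) /=; last by move=> s t _ /andP[].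
apply: eq_bigr => s sD; rewrite (eq_bigr (G s)) => [|t _]; last exact: Gsym.
by apply: eq_bigl => t; rewrite sD.
Qed.

(** A flag is a maximal simplex of a cell: it starts at a vertex and takes one
step in each of the directions of the cell, in some order. *)
Section flags.
Variables (T : Type) (n : nat) (step : 'I_n -> T -> T).
Hypothesis stepC : forall s t x, step s (step t x) = step t (step s x).
Variable lab : 'I_n -> T -> 'F_2.

(** The cup product of the coboundaries of the labels [ds], evaluated on the
cell with first vertex [x] and directions [D]: the sum, over the flags of the
cell, of the product of the jumps of the k-th label along the k-th step. *)
Fixpoint flag_sum (ds : seq 'I_n) (D : {set 'I_n}) (x : T) : 'F_2 :=
  if ds is i :: ds' then
    \sum_(s in D) (lab i x + lab i (step s x)) * flag_sum ds' (D :\ s) (step s x)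
  else 1.

(** The cup product of coboundaries is a cocycle: its sum over the faces of a
cell vanishes. The left side sums over the faces through [x], the right side
over the opposite ones. By induction on the labels, every term is either
matched by another one in which the first two steps are exchanged, or governed
by the identity for a face. *)
Lemma flag_sum_closed ds (D : {set 'I_n}) x : #|D| = (size ds).+1 ->
  \sum_(s in D) flag_sum ds (D :\ s) x =
  \sum_(s in D) flag_sum ds (D :\ s) (step s x).
Proof.
elim: ds D x => [//|i ds IH] D x cD /=.
have cDs s : s \in D -> #|D :\ s| = (size ds).+1.
  by move=> sD; move: (cardsD1 s D); rewrite sD cD => -[].
have Dst s t : D :\ s :\ t = D :\ t :\ s.
  by rewrite finset.setDDl finset.setUC -finset.setDDl.
have swap (G : 'I_n -> 'I_n -> 'F_2) :
    \sum_(s in D) \sum_(t in D :\ s) G s t = \sum_(t in D) \sum_(s in D :\ t) G s t.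
  rewrite (exchange_big_dep (mem D)) /=; last by move=> s t _ /setD1P[].
  by apply: eq_bigr => t tD; apply: eq_bigl => s; rewrite !inE eq_sym tD andbT andbC.
transitivity (\sum_(t in D) \sum_(s in D :\ t)
    lab i (step t x) * flag_sum ds (D :\ t :\ s) (step s (step t x))).
  under eq_bigr do under eq_bigr do rewrite mulrDl.
  under eq_bigr do rewrite big_split /=.
  rewrite big_split /= [X in X + _](_ : _ = 0) ?add0r.
    rewrite swap; apply: eq_bigr => t tD.
    rewrite -!mulr_sumr -IH ?cDs//; congr (_ * _).
    by apply: eq_bigr => s _; rewrite Dst.
  under eq_bigr do rewrite -mulr_sumr.
  rewrite -mulr_sumr (eq_bigr (fun s => \sum_(t in D :\ s)
      flag_sum ds (D :\ s :\ t) x)); last by move=> s sD; rewrite IH ?cDs.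
  by rewrite sum_pairsF2 ?mulr0// => s t; rewrite Dst.
symmetry; under eq_bigr do under eq_bigr do rewrite mulrDl.
under eq_bigr do rewrite big_split /=.
rewrite big_split /= [X in _ + X](_ : _ = 0) ?addr0.
  by [].
by apply: sum_pairsF2 => s t; rewrite stepC Dst.
Qed.

End flags.

Section grid.
Variables (n k : nat).
Hypothesis k_gt0 : (0 < k)%N.
Let T := {ffun 'I_n -> 'I_k.+1}.
Implicit Types (x y : T) (s i : 'I_n) (D : {set 'I_n}).

(* A step leaving the grid wraps around, which makes steps bijective. *)
Let step s x : T := [ffun i => if i == s then ordS (x i) else x i].

Let stepC s t x : step s (step t x) = step t (step s x).
Proof. by apply/ffunP => i; rewrite !ffunE; do 2!case: eqP. Qed.

Let step_bij s : bijective (step s).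
Proof.
exists (fun x => [ffun i => if i == s then ord_pred (x i) else x i]).
  by move=> x; apply/ffunP => i; rewrite !ffunE; case: eqP => // _; rewrite ordSK.
by move=> x; apply/ffunP => i; rewrite !ffunE; case: eqP => // _; rewrite ord_predK.
Qed.

Let ordSE (j : 'I_k.+1) : ordS j = (if j < k then j.+1 else 0)%N :> nat.
Proof.
rewrite /=; case: ltnP => jk; first by rewrite modn_small.
have /eqP -> : nat_of_ord j == k by rewrite eqn_leq jk -ltnS ltn_ord.
exact: modnn.
Qed.

Variable lab : 'I_n -> T -> 'F_2.
Hypothesis lab_lo : forall i x, x i = 0%N :> nat -> lab i x = 0.
Hypothesis lab_hi : forall i x, x i = k :> nat -> lab i x = 1.

Local Notation F := (flag_sum step lab).

(* The label [j] is constant on the faces that bound the grid in direction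
   [j], so its coboundary vanishes there. *)
Let flag_face j ds D x : j \in ds -> j \notin D ->
  (x j == 0%N :> nat) || (x j == k :> nat) -> F ds D x = 0.
Proof.
elim: ds D x => //= i ds IH D x; rewrite inE => jds jD xj.
apply: big1 => s sD; have js : j != s by apply: contraNneq jD => ->.
have xsj : step s x j = x j by rewrite ffunE (negbTE js).
case/predU1P: jds => [<-|jds]; last first.
  by rewrite IH ?mulr0 ?xsj// !inE (negbTE jD) andbF.
case/orP: (xj) => /eqP xje.
  by rewrite !lab_lo ?xsj// addr0 mul0r.
by rewrite !lab_hi ?xsj// addF2 mul0r.
Qed.

(* The first vertices of the cells with directions [D] of the face on which
   the other coordinates have their largest value. *)
Let box D x := [forall s, if s \in D then (x s < k)%N else x s == k :> nat].

Let box_off D s x :=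
  [forall t, (t != s) ==> (if t \in D then (x t < k)%N else x t == k :> nat)].

Let boxE D s x : s \in D -> box D x = box_off D s x && (x s < k)%N.
Proof.
move=> sD; apply/forallP/andP => [H|[/forallP H xs] t].
  by split; [apply/forallP => t; apply/implyP|have := H s; rewrite sD].
by have [->|/(implyP (H t))//] := eqVneq t s; rewrite sD.
Qed.

Let boxD1 D s x : s \in D -> box (D :\ s) x = box_off D s x && (x s == k :> nat).
Proof.
move=> sD; apply/forallP/andP => [H|[/forallP H xs] t].
  split; last by have := H s; rewrite !inE eqxx.
  by apply/forallP => t; apply/implyP => ts; have := H t; rewrite !inE ts.
rewrite !inE; have [->//|ts] := eqVneq t s.
exact: (implyP (H t)).
Qed.

Let box_step D s x : s \in D ->
  box D x = box_off D s (step s x) && (0 < step s x s)%N.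
Proof.
move=> sD; rewrite (boxE _ sD); congr (_ && _).
  by apply: eq_forallb => t; have [//|/negbTE ts] := eqVneq t s; rewrite ffunE ts.
by rewrite ffunE eqxx ordSE; case: ifP.
Qed.

Let telescope D s (G : T -> 'F_2) : s \in D ->
  \sum_(x | box D x) (G x + G (step s x)) =
  \sum_(x | box_off D s x && (x s == 0%N :> nat)) G x +
  \sum_(x | box_off D s x && (x s == k :> nat)) G x.
Proof.
move=> sD; rewrite big_split /=.
have -> : \sum_(x | box D x) G (step s x) =
    \sum_(y | box_off D s y && (0 < y s)%N) G y.
  rewrite [RHS](reindex (step s)) /=; last by apply: onW_bij.
  by apply: eq_bigl => x; rewrite (box_step _ sD).
rewrite (bigID (fun x : T => x s == 0%N :> nat)) /=.
rewrite [X in _ + X](bigID (fun x : T => x s == k :> nat)) /=.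
set A := (X in X + _ + _); set B := (X in _ + X + _).
set C := (X in _ + _ + (X + _)); set E := (X in _ + _ + (_ + X)).
have -> : A = \sum_(x | box_off D s x && (x s == 0%N :> nat)) G x.
  apply: eq_bigl => x; rewrite (boxE _ sD) -andbA; congr andb.
  by have [->|] := eqVneq (x s : nat) 0%N; rewrite ?k_gt0 ?eqxx ?andbF.
have -> : C = \sum_(x | box_off D s x && (x s == k :> nat)) G x.
  apply: eq_bigl => x; rewrite -andbA; congr andb.
  by have [->|] := eqVneq (x s : nat) k; rewrite ?k_gt0 ?eqxx ?andbF.
have -> : B = E.
  apply: eq_bigl => x; rewrite (boxE _ sD) -!andbA; congr andb.
  by rewrite lt0n andbC; congr andb; rewrite ltn_neqAle -ltnS ltn_ord andbT.
by rewrite addrACA addF2 addr0.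
Qed.

(* Stokes: summed over the face, the product is a boundary term by
   [flag_sum_closed]. In the direction of the first label, one boundary face
   contributes 0 and the other the product of the remaining labels; the other
   directions contribute nothing. So the dimension drops to 0, where the
   product is 1. *)
Let flag_total ds D : uniq ds -> D =i ds -> \sum_(x | box D x) F ds D x = 1.
Proof.
elim: ds D => [|i ds IH] D /=.
  move=> _ D0; rewrite (big_pred1 [ffun=> ord_max])// => x.
  apply/forallP/eqP => [H|-> s]; last by rewrite D0 ffunE /=.
  apply/ffunP => s; have := H s; rewrite D0 /= ffunE => /eqP xs.
  exact: val_inj.
case/andP=> ids uds DE.
have iD : i \in D by rewrite DE inE eqxx.
have cD : #|D| = (size ds).+1.
  by rewrite (eq_card DE) (card_uniqP _)//= ids.
rewrite (eq_bigr (fun x => \sum_(s in D)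
   (lab i x * F ds (D :\ s) x + lab i (step s x) * F ds (D :\ s) (step s x)))).
  rewrite exchange_big /= (bigD1 i) //= [X in _ + X]big1 => [|s /andP[sD si]]; last first.
    have sds : s \in ds by move: sD; rewrite DE inE (negbTE si).
    have snD : s \notin D :\ s by rewrite !inE eqxx.
    rewrite (telescope (fun x => lab i x * F ds (D :\ s) x) sD).
    by rewrite !big1 ?addr0// => x /andP[_ xs];
      rewrite (flag_face sds)// ?xs ?orbT ?mulr0.
  rewrite addr0 (telescope (fun x => lab i x * F ds (D :\ i) x) iD).
  rewrite big1 ?add0r => [|x /andP[_ /eqP xi]]; last by rewrite lab_lo ?mul0r.
  rewrite -(IH (D :\ i)) //; last first.
    move=> s; rewrite !inE DE inE; case: eqP => //= ->.
    by rewrite (negbTE ids).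
  rewrite [RHS](eq_bigl _ _ (fun x => boxD1 x iD)).
  by apply: eq_bigr => x /andP[_ /eqP xi]; rewrite lab_hi ?mul1r.
move=> x _; under eq_bigr do rewrite mulrDl.
rewrite !big_split /= -!mulr_sumr (@flag_sum_closed _ _ _ stepC)//.
Qed.

(* A nonzero product has a nonzero term, that is, a flag along which every
   label jumps. *)
Let flag_neq0 ds D x : (forall s, s \in D -> (x s < k)%N) -> F ds D x != 0 ->
  forall i, i \in ds -> exists y z, [/\ lab i y != lab i z,
    forall s, (x s <= y s <= x s + (s \in D))%N &
    forall s, (x s <= z s <= x s + (s \in D))%N].
Proof.
elim: ds D x => //= i ds IH D x xD Fn0 j jds.
have /exists_inP[s sD] : [exists s in D,
    (lab i x + lab i (step s x)) * F ds (D :\ s) (step s x) != 0].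
  apply: contraNT Fn0; rewrite negb_exists_in => /forall_inP H.
  by apply/eqP/big1 => s /H /negPn/eqP.
rewrite mulf_eq0 negb_or => /andP[ln0 Fsn0].
have xs t : step s x t = (x t + (t == s))%N :> nat.
  rewrite ffunE; case: eqP => [->|_]; last by rewrite addn0.
  by rewrite ordSE xD// addn1.
have eqD t : (t \in D) = ((t == s) + (t \in D :\ s))%N :> nat.
  by rewrite !inE; case: eqP => //= ->; rewrite sD.
case/predU1P: jds => [->|jds].
  exists x, (step s x); split.
  - by apply: contraNneq ln0 => ->; rewrite addF2.
  - by move=> t; rewrite leqnn leq_addr.
  - by move=> t; rewrite xs leq_addr leq_add2l eqD leq_addr.
have [|y [z [yz Hy Hz]]] := IH (D :\ s) (step s x) _ Fsn0 _ jds.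
  by move=> t /setD1P[ts tD]; rewrite xs (negbTE ts) addn0 xD.
exists y, z; split => // t.
  have /andP[/(leq_trans _) -> ] := Hy t; last by rewrite xs leq_addr.
  by rewrite xs eqD addnA.
have /andP[/(leq_trans _) -> ] := Hz t; last by rewrite xs leq_addr.
by rewrite xs eqD addnA.
Qed.

(** Some cell meets a jump of every label: the sum of the cup product over all
cells of the grid is 1, hence it is not 0 on some cell. *)
Lemma kuhn : exists x, forall i, exists y z, [/\ lab i y != lab i z,
    forall s, (x s <= y s <= (x s).+1)%N & forall s, (x s <= z s <= (x s).+1)%N].
Proof.
pose D := [set: 'I_n]%SET.
have D1 : D =i enum 'I_n by move=> s; rewrite mem_enum inE.
have := flag_total (enum_uniq 'I_n) D1.
have [/exists_inP[x bx Fx] _|] := boolP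
  [exists x in [pred x | box D x], F (enum 'I_n) D x != 0]; last first.
  rewrite negb_exists_in => /forall_inP H.
  by rewrite big1 => [/eqP//|x bx]; first by have /negPn/eqP := H x bx.
exists x => i.
have [|y [z [yz Hy Hz]]] := flag_neq0 _ Fx (mem_enum 'I_n i).
  by move=> s _; have /forallP/(_ s) := bx; rewrite inE.
by exists y, z; split => // s; [have := Hy s|have := Hz s]; rewrite inE addn1.
Qed.

End grid.

(** * Continuity of elementary constructions *)

Lemma continuous_mx (T U : topologicalType) m n (f : T -> 'M[U]_(m, n)) :
  (forall i j, continuous (fun x => f x i j)) -> continuous f.
Proof.
move=> cf x W [P Px PW]; rewrite nbhs_simpl /=.
have : \forall y \near x, forall i j, P i j (f y i j).
  apply: filter_forall => i; apply: filter_forall => j.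
  exact: (cf i j x _ (Px i j)).
by apply: filterS => y /= Py; exact: PW.
Qed.

Lemma continuous_pair (T U V : topologicalType) (f : T -> U) (g : T -> V) x :
  {for x, continuous f} -> {for x, continuous g} ->
  {for x, continuous (fun y => (f y, g y))}.
Proof. by move=> cf cg; apply: cvg_pair. Qed.

Lemma continuous_mul (R : realType) (T : topologicalType) (f g : T -> R) :
  continuous f -> continuous g -> continuous (fun x => f x * g x).
Proof. by move=> cf cg x; apply: cvgM; [exact: cf|exact: cg]. Qed.

Lemma continuous_sub (R : realType) (T : topologicalType) (f g : T -> R) :
  continuous f -> continuous g -> continuous (fun x => f x - g x).
Proof. by move=> cf cg x; apply: cvgB; [exact: cf|exact: cg]. Qed.

Lemma continuous_compose (T U V : topologicalType) (f : T -> U) (g : U -> V) :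
  continuous f -> continuous g -> continuous (fun x => g (f x)).
Proof. by move=> cf cg x; apply: continuous_comp; [exact: cf|exact: cg]. Qed.

Lemma continuous_pairing (T U V : topologicalType) (f : T -> U) (g : T -> V) :
  continuous f -> continuous g -> continuous (fun x => (f x, g x)).
Proof. by move=> cf cg x; apply: continuous_pair; [exact: cf|exact: cg]. Qed.

Lemma continuous_add (R : realType) (T : topologicalType) (f g : T -> R) :
  continuous f -> continuous g -> continuous (fun x => f x + g x).
Proof. by move=> cf cg x; apply: cvgD; [exact: cf|exact: cg]. Qed.

Lemma continuous_pasting (T X : topologicalType) (R : realType)
    (r : T -> R) (c : R) (f g : T -> X) :
  continuous r -> continuous f -> continuous g ->
  (forall x, r x = c -> f x = g x) ->
  continuous (fun x => if r x <= c then f x else g x).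
Proof.
move=> cr cf cg fg x B.
have nbf : nbhs (f x) B -> \forall y \near x, B (f y) by move=> /cf.
have nbg : nbhs (g x) B -> \forall y \near x, B (g y) by move=> /cg.
suff : nbhs (if r x <= c then f x else g x) B ->
    \forall y \near x, B (if r y <= c then f y else g y) by [].
have [rxc|rxc|rxc] := ltgtP (r x) c.
- have rlt : \forall y \near x, r y < c.
    exact: (cr x _ (open_nbhs_nbhs (conj (@open_lt _ c) rxc))).
  by move=> /nbf fB; apply: filterS2 fB rlt => y fy ryc; rewrite ltW.
- have rgt : \forall y \near x, c < r y.
    exact: (cr x _ (open_nbhs_nbhs (conj (@open_gt _ c) rxc))).
  by move=> /nbg gB; apply: filterS2 gB rgt => y gy ryc; rewrite leNgt ryc.
- move=> /[dup] /nbf fB; rewrite (fg _ rxc) => /nbg gB.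
  by apply: filterS2 fB gB => y fy gy; case: ifP.
Qed.

Lemma set_type_hausdorff (X : topologicalType) (A : set X) :
  hausdorff_space X -> hausdorff_space A.
Proof.
move=> hX x y xy; apply/val_inj/hX => P Q nP nQ.
have c := @initial_continuous _ _ (set_val : A -> X).
by have [z [Pz Qz]] := xy _ _ (c _ _ nP) (c _ _ nQ); exists (set_val z).
Qed.

(** * Brouwer's fixed point theorem *)

Section brouwer.
Variables (R : realType) (N : nat) (f : 'rV[R]_N -> 'rV[R]_N).
Hypothesis cf : continuous f.
Hypothesis f_cube : forall x i, -1 <= f x 0 i <= 1.

Let grid_pt K (y : {ffun 'I_N -> 'I_K.+2}) : 'rV[R]_N :=
  \row_i ((y i)%:R / K.+1%:R * 2 - 1).

Let grid_pt_cube K y i : -1 <= @grid_pt K y 0 i <= 1.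
Proof.
rewrite mxE; have K0 : 0 < (K.+1%:R : R) by [].
have y0 : 0 <= (y i)%:R / K.+1%:R :> R by rewrite divr_ge0.
have y1 : (y i)%:R / K.+1%:R <= 1 :> R.
  by rewrite ler_pdivrMr// mul1r ler_nat -ltnS.
by move: (_ / _) y0 y1 => q q0 q1; apply/andP; split; lra.
Qed.

(* The sign of the displacement in direction [i]. On the faces bounding the
   cube in direction [i], where that sign is known, the label is forced. *)
Let grid_label K i (y : {ffun 'I_N -> 'I_K.+2}) : 'F_2 :=
  if y i == 0%N :> nat then 0 else if y i == K.+1 :> nat then 1 else
  if grid_pt y 0 i <= f (grid_pt y) 0 i then 0 else 1.

Let label0 K i y : @grid_label K i y = 0 -> grid_pt y 0 i <= f (grid_pt y) 0 i.
Proof.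
rewrite /grid_label; have [yi _|y0] := eqVneq (y i : nat) 0%N.
  by have /andP[+ _] := f_cube (grid_pt y) i; rewrite [grid_pt y _ _]mxE yi !mul0r add0r.
by case: eqP => // _; case: ifP.
Qed.

Let label1 K i y : @grid_label K i y = 1 -> f (grid_pt y) 0 i <= grid_pt y 0 i.
Proof.
rewrite /grid_label; have [yi //|y0] := eqVneq (y i : nat) 0%N.
have [yi _|_] := eqVneq (y i : nat) K.+1.
  have /andP[_] := f_cube (grid_pt y) i.
  by rewrite [grid_pt y _ _]mxE yi divff// ; lra.
by case: ifPn => // + _; rewrite -ltNge => /ltW.
Qed.

Let grid_near K (x y : {ffun 'I_N -> 'I_K.+2}) e : 0 < e ->
  K.+1%:R^-1 < e / 2 -> (forall s, (x s <= y s <= (x s).+1)%N) ->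
  ball (grid_pt x) e (grid_pt y).
Proof.
move=> e0 Ke xy; split=> // i j; rewrite !mxE /ball /=.
have [d [yd d1]] : exists d : nat, (y j = x j + d :> nat)%N /\ (d <= 1)%N.
  exists (y j - x j)%N; have /andP[xj yj] := xy j.
  by rewrite subnKC// leq_subLR addn1.
rewrite yd natrD; set a := (x j)%:R; set k := K.+1%:R^-1 in Ke *.
have k0 : 0 < k by rewrite invr_gt0.
rewrite (_ : _ - _ = - (d%:R * k * 2)); last by lra.
rewrite normrN ger0_norm; last by rewrite !mulr_ge0// ltW.
have : d%:R * k <= k by apply: ler_piMl; [exact: ltW|rewrite -[1]/(1%:R) ler_nat].
by lra.
Qed.

(* At the scale of the grid, both signs of the displacement appear near one
   point, in every direction. *)
Let small_cell K : exists x : 'rV[R]_N, (forall i, -1 <= x 0 i <= 1) /\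
  forall e, 0 < e -> K.+1%:R^-1 < e / 2 ->
  forall i, exists y z, [/\ ball x e y, ball x e z,
    y 0 i <= f y 0 i & f z 0 i <= z 0 i].
Proof.
have [||x xP] := @kuhn N K.+1 isT (@grid_label K).
- by move=> i x xi; rewrite /grid_label xi.
- by move=> i x xi; rewrite /grid_label xi eqxx.
exists (grid_pt x); split => [i|e e0 Ke i]; first exact: grid_pt_cube.
have [y [z [yz xy xz]]] := xP i.
have F2 (b : 'F_2) : b = 0 \/ b = 1.
  by case: b => -[|[|//]] ?; [left|right]; apply: val_inj.
have [yb|yb] := F2 (grid_label i y); have [zb|zb] := F2 (grid_label i z).
- by rewrite yb zb eqxx in yz.
- exists (grid_pt y), (grid_pt z); split; by [exact: grid_near|exact: label0|exact: label1].
- exists (grid_pt z), (grid_pt y); split; by [exact: grid_near|exact: label0|exact: label1].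
- by rewrite yb zb eqxx in yz.
Qed.

(** At a limit of the points given by ever finer grids, no coordinate of the
displacement is positive or negative, by continuity. *)
Lemma brouwer : exists x, f x = x.
Proof.
apply: contrapT => nofix.
have [p pP] := choice small_cell.
have cptC : compact [set v : 'rV[R]_N | forall i, v ord0 i \in `[(-1 : R), (1 : R)]].
  apply: (@rV_compact _ _ (fun=> `[(-1 : R), (1 : R)]%classic)) => _.
  exact: segment_compact.
have [|q [_ qcl]] := cptC (p @ \oo) _.
  by exists 0%N => // K _ i; rewrite in_itv /=; exact: (pP K).1.
have [i fqi] : exists i, f q 0 i != q 0 i.
  apply: contrapT => /forallNP fq; apply: nofix; exists q; apply/rowP => i.
  by have /negP/negPn/eqP := fq i.
pose g x := f x 0 i - x 0 i.
have cg : continuous g.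
  move=> x; apply: (@continuousB _ _ _ (fun x => f x 0 i) (fun x => x 0 i)).
    by apply: (@continuous_comp _ _ _ f (fun M => M 0 i)); [exact: cf|exact: coord_continuous].
  exact: coord_continuous.
have main (W : set R) : open W -> W (g q) ->
    exists y z, [/\ W (g y), W (g z), 0 <= g y & g z <= 0].
  move=> oW Wq; have /nbhs_ballP[e /= e0 eW] : nbhs q (g @^-1` W).
    by apply: cg; exact: open_nbhs_nbhs.
  have e20 : 0 < e / 2 / 2 by rewrite !divr_gt0.
  pose A := [set x | exists2 K, x = p K & K.+1%:R^-1 < e / 2 / 2].
  have qe := nbhsx_ballx q _ (divr_gt0 e0 (ltr0Sn _ 1)).
  have [|_ [[K -> Ke] qp]] := qcl A (ball q (e / 2)) _ qe.
    suff : \forall K \near \oo, A (p K) by [].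
    have := near_infty_natSinv_lt (PosNum e20).
    by apply: filterS => K /= Ke; exists K.
  have [y [z [xy xz fy fz]]] := (pP K).2 _ (divr_gt0 e0 (ltr0Sn _ 1)) Ke i.
  exists y, z; split; rewrite ?subr_ge0 ?subr_le0//; apply: eW; 
    rewrite (splitr e); exact: ball_triangle qp _.
have [gq|gq] : 0 < g q \/ g q < 0.
  by apply/orP; rewrite -neq_lt eq_sym subr_eq0.
  have [y [z [_ gz _ gz0]]] := main [set x | 0 < x] (@open_gt _ 0) gq.
  by move: gz; rewrite /= ltNge gz0.
have [y [z [gy _ gy0 _]]] := main [set x | x < 0] (@open_lt _ 0) gq.
by move: gy; rewrite /= ltNge gy0.
Qed.

End brouwer.

(** * Radial projection to a sphere *)

Section sphere_normalization.
Variables (R : realType) (d : nat).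
Implicit Types u v : 'rV[R]_d.+1.

Definition sqnorm u : R := \sum_i u 0 i ^+ 2.

Lemma sqnorm_ge0 u : 0 <= sqnorm u.
Proof. by apply: sumr_ge0 => i _; exact: sqr_ge0. Qed.

Lemma sqnorm_eq0 u : (sqnorm u == 0) = (u == 0).
Proof.
rewrite psumr_eq0 => [|i _]; last exact: sqr_ge0.
apply/allP/eqP => [u0|-> i _]; last by rewrite mxE expr0n eqxx.
by apply/rowP => i; have := u0 i (mem_index_enum i); rewrite /= sqrf_eq0 mxE => /eqP.
Qed.

Lemma sqnormZ c u : sqnorm (c *: u) = c ^+ 2 * sqnorm u.
Proof. by rewrite /sqnorm mulr_sumr; apply: eq_bigr => i _; rewrite mxE exprMn. Qed.

Lemma sqnormN u : sqnorm (- u) = sqnorm u.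
Proof. by apply: eq_bigr => i _; rewrite mxE sqrrN. Qed.

Lemma sqnorm_val (x : sphere R d) : sqnorm (set_val x) = 1.
Proof. exact: set_mem (valP x). Qed.

Lemma sqnorm_continuous : continuous sqnorm.
Proof.
apply: (@continuous_big _ _ +%R 0 xpredT _ _ _ (fun i (u : 'rV[R]_d.+1) => u 0 i ^+ 2)).
  exact: add_continuous.
move=> i _ u; have ci := @coord_continuous R 1 d.+1 0 i.
exact: (@continuousM _ _ (fun u : 'rV[R]_d.+1 => u 0 i)
  (fun u : 'rV[R]_d.+1 => u 0 i) u (ci u) (ci u)).
Qed.

Lemma sphere_neq0 (x : sphere R d) : set_val x != 0.
Proof. by rewrite -sqnorm_eq0 sqnorm_val oner_neq0. Qed.

Lemma sphere_coord_le1 (x : sphere R d) i : `|set_val x 0 i| <= 1.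
Proof.
rewrite -(@expr_le1 _ 2)// real_normK ?num_real// -(sqnorm_val x).
by rewrite /sqnorm (bigD1 i)//= lerDl sumr_ge0// => j _; exact: sqr_ge0.
Qed.

Definition direction u : sphere R d :=
  insubd (sphere_pt R d) ((Num.sqrt (sqnorm u))^-1 *: u).

Lemma direction_val u : u != 0 ->
  set_val (direction u) = (Num.sqrt (sqnorm u))^-1 *: u.
Proof.
rewrite -sqnorm_eq0 => u0; apply: insubdK; rewrite inE /sphere /=.
by rewrite -/(sqnorm _) sqnormZ exprVn sqr_sqrtr ?sqnorm_ge0// mulVf.
Qed.

Lemma direction_id (x : sphere R d) : direction (set_val x) = x.
Proof.
apply: val_inj; rewrite -[LHS]/(set_val _) direction_val ?sphere_neq0//.
by rewrite sqnorm_val sqrtr1 invr1 scale1r.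
Qed.

Lemma direction_continuous u : u != 0 -> {for u, continuous direction}.
Proof.
move=> u0.
have cv : {for u, continuous (fun v => (Num.sqrt (sqnorm v))^-1 *: v)}.
  apply: continuousZ; last exact: cvg_id.
  apply: continuousV.
    by rewrite sqrtr_eq0 -ltNge lt_neqAle sqnorm_ge0 eq_sym sqnorm_eq0 u0.
  by apply: continuous_comp; [exact: sqnorm_continuous|exact: sqrt_continuous].
move=> W /= [_ [[B oB <-] /= Bu] BW].
rewrite nbhs_simpl /=.
have n0 : \forall v \near u, v != 0.
  have on0 : open (sqnorm @^-1` [set x | x != 0]).
    by apply: open_comp; [move=> ? _; exact: sqnorm_continuous|exact: open_neq].
  apply: filterS (open_nbhs_nbhs (conj on0 _)) => [v|] /=; first by rewrite sqnorm_eq0.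
  by rewrite sqnorm_eq0.
have nO : \forall v \near u, B ((Num.sqrt (sqnorm v))^-1 *: v).
  apply: cv; apply: open_nbhs_nbhs; split=> //.
  by rewrite -direction_val.
by apply: filterS2 n0 nO => v v0 Bv; apply: BW; rewrite /= direction_val.
Qed.

End sphere_normalization.

(** * Contracting both projections of a product of two spheres *)

Section no_cover.
Variables (R : realType) (d e : nat).
Local Notation Z := (sphere R d * sphere R e)%type.
Local Notation E := 'rV[R]_(d.+1 + e.+1).

(* The vector space contains the product of the spheres; [dir] retracts onto it
   the vectors with nonzero components, and [defect] vanishes on it and is
   larger than 1 near the vectors where [dir] jumps. *)
Let dir (w : E) : Z := (direction (lsubmx w), direction (rsubmx w)).
Let defect (w : E) : R := 2 * (1 - sqnorm (lsubmx w) * sqnorm (rsubmx w)).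

Let lsubmx_continuous : continuous (lsubmx : E -> 'rV[R]_d.+1).
Proof.
apply: continuous_mx => i j; under eq_fun do rewrite mxE.
exact: coord_continuous.
Qed.

Let rsubmx_continuous : continuous (rsubmx : E -> 'rV[R]_e.+1).
Proof.
apply: continuous_mx => i j; under eq_fun do rewrite mxE.
exact: coord_continuous.
Qed.

Let defect_continuous : continuous defect.
Proof.
apply: continuous_mul; first exact: cst_continuous.
apply: continuous_sub; first exact: cst_continuous.
apply: continuous_mul.
  exact: continuous_compose lsubmx_continuous (@sqnorm_continuous R d).
exact: continuous_compose rsubmx_continuous (@sqnorm_continuous R e).
Qed.

Let dir_continuous w : lsubmx w != 0 -> rsubmx w != 0 -> {for w, continuous dir}.
Proof.
move=> u0 v0; apply: continuous_pair.
  by apply: continuous_comp; [exact: lsubmx_continuous|exact: direction_continuous].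
by apply: continuous_comp; [exact: rsubmx_continuous|exact: direction_continuous].
Qed.

(* Borsuk's extension of a map that is homotopic over [V] to a constant: the
   time [tau] exceeds 1 outside [V], and the defect exceeds 1 near the vectors
   where [dir] jumps, so that near every vector either the homotopy has reached
   its constant end or all the functions involved are continuous. *)
Let extension (Y : topologicalType) (V : set Z) (K : Z * R -> Y) (c : Y)
    (tau : Z -> R) :
  (forall z t, V z -> {for (z, t), continuous K}) ->
  (forall z t, 1 <= t -> K (z, t) = c) ->
  continuous tau -> (forall z, ~ V z -> 1 < tau z) ->
  continuous (fun w => K (dir w, Num.max (tau (dir w)) (defect w))).
Proof.
move=> cK Kc ctau tauV w.
have [d1|d1] := ltP 1 (defect w).
  have near_d1 : \forall w' \near w, 1 < defect w'.
    exact: (defect_continuous (open_nbhs_nbhs (conj (@open_gt _ 1) d1))).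
  apply: (near_cst_continuous c).
  by apply: filterS near_d1 => w' d1'; rewrite Kc// le_max (ltW d1') orbT.
have [u0 v0] : lsubmx w != 0 /\ rsubmx w != 0.
  apply/andP; rewrite -!sqnorm_eq0 -negb_or -mulf_eq0; apply: contraTN d1 => /eqP uv0.
  by rewrite /defect uv0 subr0 mulr1 -ltNge ltr1n.
have cd := dir_continuous u0 v0.
have ct : {for w, continuous (tau \o dir)}.
  by apply: continuous_comp => //; exact: ctau.
have [Vz|nVz] := pselect (V (dir w)).
  apply: (@continuous_comp _ _ _ (fun w => (dir w, Num.max (tau (dir w)) (defect w))) K).
    apply: continuous_pair => //.
    by apply: continuous_max => //; exact: defect_continuous.
  exact: cK.
have near_t1 : \forall w' \near w, 1 < tau (dir w').
  exact: (ct _ (open_nbhs_nbhs (conj (@open_gt _ 1) (tauV _ nVz)))).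
apply: (near_cst_continuous c).
by apply: filterS near_t1 => w' t1; rewrite Kc// le_max (ltW t1).
Qed.

(** The homotopies have real times and are stationary from time 1 on, so that
any continuous function can serve as their time. *)
Lemma no_cover_contracting_projections (V W : set Z)
    (K : Z * R -> sphere R d) (L : Z * R -> sphere R e) p q :
  open V -> open W -> V `|` W = setT ->
  (forall z t, V z -> {for (z, t), continuous K}) ->
  (forall z t, W z -> {for (z, t), continuous L}) ->
  (forall z t, V z -> t <= 0 -> K (z, t) = z.1) ->
  (forall z t, W z -> t <= 0 -> L (z, t) = z.2) ->
  (forall z t, 1 <= t -> K (z, t) = p) ->
  (forall z t, 1 <= t -> L (z, t) = q) -> False.
Proof.
move=> oV oW VW cK cL K0 L0 K1 L1.
have sep : uniform_separator (~` V) (~` W).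
  apply: (@normal_separatorP R Z).1; first exact: pseudometric_normal.
  - exact: open_closedC.
  - exact: open_closedC.
  - by rewrite -setCU VW setCT.
pose phi := @Urysohn Z R (~` V) (~` W).
have cphi : continuous phi by exact: Urysohn_continuous.
have phiV z : ~ V z -> phi z = 0 by move=> ?; apply: (Urysohn_sub0 sep); exists z.
have phiW z : ~ W z -> phi z = 1 by move=> ?; apply: (Urysohn_sub1 sep); exists z.
(* The function [phi] is 0 outside [V] and 1 outside [W]. The time [tauV] is at
   most 0 where [phi] is at least 1/2 and exceeds 1 outside [V]; the time
   [tauW] does the same on the other side of 1/2. *)
pose tauV z := 3 - 6 * phi z; pose tauW z := 6 * phi z - 3.
have ctV : continuous tauV.
  apply: continuous_sub; first exact: cst_continuous.
  by apply: continuous_mul => //; exact: cst_continuous.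
have ctW : continuous tauW.
  apply: continuous_sub; last exact: cst_continuous.
  by apply: continuous_mul => //; exact: cst_continuous.
pose f w := K (dir w, Num.max (tauV (dir w)) (defect w)).
pose g w := L (dir w, Num.max (tauW (dir w)) (defect w)).
have cf : continuous f.
  by apply: (extension cK K1 ctV) => z /phiV; rewrite /tauV => ->; lra.
have cg : continuous g.
  by apply: (extension cL L1 ctW) => z /phiW; rewrite /tauW => ->; lra.
pose F (w : E) : E := row_mx (- set_val (f w)) (- set_val (g w)).
have coordN m (i : 'I_1) (k : 'I_m.+1) :
    continuous (fun x : sphere R m => (- set_val x) i k).
  under eq_fun do rewrite mxE.
  apply: (@continuous_compose _ _ _ (fun x : sphere R m => set_val x i k) -%R).
    apply: (@continuous_compose _ _ _ set_val (fun u : 'rV[R]_m.+1 => u i k)).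
      exact: initial_continuous.
    exact: coord_continuous.
  exact: opp_continuous.
have cF : continuous F.
  apply: continuous_mx => i j; case: (split_ordP j) => k ->.
    under eq_fun do rewrite row_mxEl.
    exact: continuous_compose cf (coordN _ _ _).
  under eq_fun do rewrite row_mxEr.
  exact: continuous_compose cg (coordN _ _ _).
have F_cube w i : -1 <= F w 0 i <= 1.
  by rewrite -ler_norml; case: (split_ordP i) => k ->;
    rewrite ?row_mxEl ?row_mxEr mxE normrN sphere_coord_le1.
(* A fixed point has components of norm 1, hence no defect. *)
have [w Fw] := brouwer cF F_cube.
have lw : lsubmx w = - set_val (f w) by rewrite -{1}Fw row_mxKl.
have rw : rsubmx w = - set_val (g w) by rewrite -{1}Fw row_mxKr.
have defw : defect w = 0 by rewrite /defect lw rw !sqnormN !sqnorm_val mulr1 subrr mulr0.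
have self_opp m (x : sphere R m) : set_val x != - set_val x.
  by rewrite -addr_eq0 -mulr2n -scaler_nat scaler_eq0 negb_or pnatr_eq0 sphere_neq0.
have dirN m (u : 'rV[R]_m.+1) (x : sphere R m) : u = - set_val x -> set_val (direction u) = u.
  move=> ux; rewrite direction_val; first by rewrite ux sqnormN sqnorm_val sqrtr1 invr1 scale1r.
  by rewrite ux oppr_eq0 sphere_neq0.
have half0 : 0 <= 1 / 2 :> R by lra.
have half1 : 1 / 2 < 1 :> R by lra.
have [half|half] := leP (phi (dir w)) (1 / 2).
  have Wz : W (dir w).
    by apply: contrapT => /phiW p1; move: half; rewrite p1 leNgt half1.
  have : g w = direction (rsubmx w).
    by rewrite /g L0// ge_max defw lexx andbT /tauW; lra.
  move/(congr1 set_val); rewrite (dirN _ _ _ rw) rw => /eqP.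
  by apply/negP; exact: self_opp.
have Vz : V (dir w).
  by apply: contrapT => /phiV p1; move: half; rewrite p1 ltNge half0.
have : f w = direction (lsubmx w).
  by rewrite /f K0// ge_max defw lexx andbT /tauV; lra.
move/(congr1 set_val); rewrite (dirN _ _ _ lw) lw => /eqP.
by apply/negP; exact: self_opp.
Qed.

End no_cover.

(** * Sections over open sets as homotopies *)

Section unit_interval_clamp.
Variable R : realType.

Lemma clamp_subproof (t : R) : Num.max 0 (Num.min t 1) \in unit_interval R.
Proof.
rewrite inE /unit_interval /= in_itv /= le_max lexx /=.
by rewrite ge_max ler01 ge_min lexx orbT.
Qed.

Definition clamp (t : R) : unit_interval R :=
  exist _ (Num.max 0 (Num.min t 1)) (clamp_subproof t).

Lemma clamp_continuous : continuous clamp.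
Proof.
apply: continuous_comp_initial => t.
apply: (@continuous_max R R (fun=> 0) (fun t => Num.min t 1)).
  exact: cst_continuous.
by apply: (@continuous_min R R id (fun=> 1)); [exact: cvg_id|exact: cst_continuous].
Qed.

Lemma clamp_le0 t : t <= 0 -> clamp t = itv_zero R.
Proof.
move=> t0; apply: val_inj => /=.
by rewrite min_l ?(le_trans t0)// max_l.
Qed.

Lemma clamp_ge1 t : 1 <= t -> clamp t = itv_one R.
Proof. by move=> t1; apply: val_inj; rewrite /= min_r// max_r. Qed.

Lemma clamp_val (x : unit_interval R) : clamp (set_val x) = x.
Proof.
apply: val_inj => /=; have := set_mem (valP x).
by rewrite /unit_interval /= in_itv /= => /andP[x0 x1]; rewrite min_l// max_r.
Qed.

Lemma unit_interval_compact : compact [set: unit_interval R].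
Proof.
have -> : [set: unit_interval R] = clamp @` `[0, 1].
  apply/seteqP; split => // x _; exists (set_val x); last exact: clamp_val.
  exact: set_mem (valP x).
apply: continuous_compact; last exact: segment_compact.
exact/continuous_subspaceT/clamp_continuous.
Qed.

Lemma unit_interval_locally_compact : locally_compact [set: unit_interval R].
Proof.
move=> x _; exists setT; first exact: filterT.
by split; [exact: unit_interval_compact|exact: closedT].
Qed.

End unit_interval_clamp.

(** The unit interval is compact and Hausdorff, so the exponential law holds:
paths depend continuously on the point in the compact-open topology if and
only if they are jointly continuous. *)
Lemma section_eval_continuous (R : realType) (T X : topologicalType) (Y : set X)
    (s : T -> path_space R Y) : continuous s ->
  continuous (fun zt : T * unit_interval R => set_val (s zt.1) zt.2).
Proof.
move=> cs.
have -> : (fun zt : T * unit_interval R => set_val (s zt.1) zt.2) =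
  uncurry (fun z => set_val (s z) : unit_interval R -> X) by apply/funext => -[].
apply: continuous_uncurry.
- exact: unit_interval_locally_compact.
- exact/set_type_hausdorff/norm_hausdorff.
- apply: (@continuous_compose _ (path_space R Y)
    {compact-open, unit_interval R -> X} s set_val) => //.
  exact: initial_continuous.
- by move=> z; have [] := set_mem (valP (s z)).
Qed.

(** A section over [U] is a homotopy over [U] between the two projections. It is
extended by a constant outside [U], which is harmless as its continuity is only
claimed over [U], and by the ends of the paths outside the unit interval. *)
Lemma section_homotopy (R : realType) (X Z S : topologicalType) (Y : set X)
    (U : set (X * Y)) (s : U -> path_space R Y) (j : Z -> X * Y) (r : X -> S)
    (p : S) :
  open U -> continuous s -> (forall x, path_ends R Y (s x) = set_val x) ->
  continuous j -> continuous r ->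
  exists K : Z * R -> S,
  [/\ forall z t, U (j z) -> {for (z, t), continuous K},
      forall z t, U (j z) -> t <= 0 -> K (z, t) = r (j z).1,
      forall z t, U (j z) -> 1 <= t -> K (z, t) = r (set_val (j z).2) &
      forall z t, ~ U (j z) -> K (z, t) = p].
Proof.
move=> oU cs sE cj cr.
pose G (ut : U * R) := r (set_val (s ut.1) (clamp ut.2)).
have cG : continuous G.
  apply: continuous_compose cr.
  apply: (@continuous_compose _ _ _ (fun ut : U * R => (ut.1, clamp ut.2))
    (fun zt => set_val (s zt.1) zt.2)); last exact: section_eval_continuous.
  move=> ut; apply: continuous_pair; first exact: cvg_fst.
  by apply: continuous_comp; [exact: cvg_snd|exact: clamp_continuous].
have insubU z : U (j z) -> exists2 u : U, insub (j z) = Some u & set_val u = j z.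
  by move=> /mem_set Uz; case: insubP => [u _ <-|/negP//]; exists u.
exists (fun zt => if insub (j zt.1) is Some u then G (u, zt.2) else p); split.
- move=> z t /[dup] Uz /insubU[u uE uz] W /=; rewrite uE => /cG.
  move=> [[P Q] /= [[_ [[B oB <-] /= Bz] BP] Qt] PQW].
  exists ([set z | B (j z)] `&` [set z | U (j z)], Q).
    split => //; apply: filterI; apply: cj; apply: open_nbhs_nbhs => //.
    by rewrite uz in Bz.
  move=> [z' t'] [[/= Bz' Uz'] Qt'].
  have [u' -> uz'] := insubU _ Uz'; apply: (PQW (_, _)); split => //=.
  by apply: BP; rewrite /= uz'.
- move=> z t /insubU[u /= -> <-] t0; rewrite /G /= clamp_le0//.
  by rewrite -(sE u).
- move=> z t /insubU[u /= -> <-] t1; rewrite /G /= clamp_ge1//.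
  by rewrite -(sE u).
- by move=> z t nUz /=; rewrite insubF//; apply/negP => /set_mem.
Qed.

(** * Lower bounds for wedges of spheres *)

Lemma has_sectional_coverS (E B : topologicalType) (f : E -> B) k :
  has_sectional_cover f k -> has_sectional_cover f k.+1.
Proof.
move=> [U [oU Ucov sU]].
exists (fun i : 'I_k.+1 => if insub (val i) is Some i' then U i' else set0); split.
- by move=> i; case: insubP => [i' _ _|_]; [exact: oU|exact: open0].
- rewrite -subTset -Ucov => x [i _ Ux]; exists (widen_ord (leqnSn k) i) => //=.
  by case: insubP => [i' _ /val_inj ->|]; rewrite ?ltn_ord.
- move=> i; case: insubP => [i' _ _|_]; first exact: sU.
  have no (x : (set0 : set B)) : False by exact: set_mem (valP x).
  by exists (fun x => match no x with end); split=> x; case: (no x).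
Qed.

Lemma has_sectional_cover_leq (E B : topologicalType) (f : E -> B) k l :
  (k <= l)%N -> has_sectional_cover f k -> has_sectional_cover f l.
Proof.
move/subnK => <-; elim: (l - k)%N => [//|m IH] fk.
exact/has_sectional_coverS/IH.
Qed.

Section wedge_lower_bounds.
Variables (R : realType) (n : nat) (a : 'I_n -> nat).
Local Notation W := (sphere_wedge R a).
Local Notation base := (fun i : 'I_n => sphere_pt R (a i)).

Definition wedge_retract (i : 'I_n) (x : W) : sphere R (a i) :=
  @wedge_prod _ _ base x i.

Lemma wedge_retract_continuous i : continuous (@wedge_retract i).
Proof.
apply: (@continuous_compose _ (prod_topology (fun i : 'I_n => sphere R (a i)))
  _ (@wedge_prod _ _ base) (proj i)); first exact: wedge_prod_continuous.
exact: proj_continuous.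
Qed.

Lemma wedge_retract_lift i (x : sphere R (a i)) :
  wedge_retract i (wedge_lift base x) = x.
Proof.
rewrite /wedge_retract /wedge_prod wedge_lift_funE ?dfwithin//.
exact: wedge_prod_pointE.
Qed.

Lemma wedge_retract_lift_neq i k (x : sphere R (a k)) : i != k ->
  wedge_retract i (wedge_lift base x) = sphere_pt R (a i).
Proof.
move=> ik; rewrite /wedge_retract /wedge_prod wedge_lift_funE ?dfwithout 1?eq_sym//.
exact: wedge_prod_pointE.
Qed.

(** A section would contract a sphere of the wedge. *)
Lemma wedge_point_not_1cover (p : W) : (0 < n)%N ->
  ~ has_sectional_cover (path_ends R [set p]) 1.
Proof.
move=> n_gt0 [U [oU Ucov sU]].
have UT x : U ord0 x.
  by have : [set: _] x by []; rewrite -Ucov => -[i _]; rewrite (ord1 i).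
pose i := Ordinal n_gt0; pose d := a i.
pose pp : [set p] := exist (fun x => x \in [set p]) p (mem_set (erefl p)).
pose j (z : sphere R d * sphere R d) : W * [set p] := (wedge_lift base z.1, pp).
have cj : continuous j.
  move=> z; apply: (@continuous_pair _ _ _ (fun z => wedge_lift base z.1)
    (fun=> pp)); last exact: cst_continuous.
  by apply: continuous_comp; [exact: cvg_fst|exact: wedge_lift_continuous].
have [s [cs sE]] := sU ord0.
have [K [cK K0 K1 _]] := section_homotopy (wedge_retract i p) (oU ord0) cs sE
  cj (@wedge_retract_continuous i).
apply: (@no_cover_contracting_projections R d d setT set0 K
  (fun=> sphere_pt R d) (wedge_retract i p) (sphere_pt R d)) => //.
- exact: openT.
- by rewrite setU0.
- by move=> z t _; exact: cK.
- by move=> z t _ t0; rewrite K0// /j /= wedge_retract_lift.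
- by move=> z t t1; rewrite K1.
Qed.

(** The sphere of index [m] lies outside the subspace, that of index 0 inside. A
path that joins a point of the former to a point of the latter contracts its
start in the former and, run backwards, its end in the latter. *)
Lemma wedge_subwedge_not_2cover m : (0 < m < n)%N ->
  ~ has_sectional_cover (path_ends R (sphere_subwedge R a m)) 2.
Proof.
move=> /andP[m_gt0 mn] [U [oU Ucov sU]].
pose b := Ordinal mn; pose c := Ordinal (ltn_trans m_gt0 mn).
have bc : b != c by rewrite -val_eqE /= -lt0n.
have Yc (y : sphere R (a c)) : wedge_lift base y \in sphere_subwedge R a m.
  by apply/mem_set; exists c => //; exists y.
pose yc (y : sphere R (a c)) : sphere_subwedge R a m :=
  exist (fun x => x \in sphere_subwedge R a m) (wedge_lift base y) (Yc y).
have cyc : continuous yc.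
  by apply: continuous_comp_initial => y; exact: wedge_lift_continuous.
pose j (z : sphere R (a b) * sphere R (a c)) := (wedge_lift base z.1, yc z.2).
have cj : continuous j.
  move=> z; apply: (@continuous_pair _ _ _ (fun z => wedge_lift base z.1)
    (fun z => yc z.2)).
    by apply: continuous_comp; [exact: cvg_fst|exact: wedge_lift_continuous].
  by apply: continuous_comp; [exact: cvg_snd|exact: cyc].
have [s [cs sE]] := sU ord0.
have [K [cK K0 K1 Kout]] := section_homotopy (sphere_pt R (a b)) (oU ord0) cs sE
  cj (@wedge_retract_continuous b).
have [s' [cs' sE']] := sU ord_max.
have [L [cL L0 L1 Lout]] := section_homotopy (sphere_pt R (a c)) (oU ord_max)
  cs' sE' cj (@wedge_retract_continuous c).
apply: (@no_cover_contracting_projections R (a b) (a c) (j @^-1` U ord0)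
  (j @^-1` U ord_max) K (fun zt => L (zt.1, 1 - zt.2)) (sphere_pt R (a b))
  (sphere_pt R (a c))) => //=.
- by apply: open_comp => // z _; exact: cj.
- by apply: open_comp => // z _; exact: cj.
- rewrite -subTset => z _; have : [set: _] (j z) by [].
  rewrite -Ucov => -[i _]; case: (unliftP ord0 i) => [k ->|->]; last by left.
  by rewrite (ord1 k) => ?; right; rewrite (_ : ord_max = lift ord0 ord0)//; exact: val_inj.
- move=> z t Uz.
  pose flip (zt : (sphere R (a b) * sphere R (a c)) * R) := (zt.1, 1 - zt.2).
  have cflip : {for (z, t), continuous flip}.
    apply: (@continuous_pair _ _ _ fst (fun zt : _ * R => 1 - zt.2)).
      exact: cvg_fst.
    by apply: cvgB; [exact: cvg_cst|exact: cvg_snd].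
  exact: (@continuous_comp _ _ _ flip L (z, t) cflip (cL _ _ Uz)).
- by move=> z t Uz t0; rewrite K0//= wedge_retract_lift.
- move=> z t Uz t0; rewrite L1 /=.
  + by rewrite wedge_retract_lift.
  + exact: Uz.
  + by rewrite lerBrDr gerDl.
- move=> z t t1; have [Uz|nUz] := pselect (U ord0 (j z)); last exact: Kout.
  by rewrite K1//= wedge_retract_lift_neq.
- move=> z t t1; have [Uz|nUz] := pselect (U ord_max (j z)); last exact: Lout.
  rewrite L0 /=; last by rewrite subr_le0.
    by rewrite wedge_retract_lift_neq// eq_sym.
  exact: Uz.
Qed.

End wedge_lower_bounds.

(** * Sections from deformations to a point *)

(** The deformations [H] move points to [b]. Where [i] and [j] tell, locally
constantly, which of them reaches [b] from either end, the paths that follow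
one deformation forwards and the other one backwards form a section. *)
Section motion_planner.
Variables (R : realType) (X : topologicalType) (Y : set X) (b : X).
Variables (H : bool -> R * X -> X).
Hypothesis cH : forall i, continuous (H i).
Hypothesis H0 : forall i x t, t <= 0 -> H i (t, x) = x.

Let bool_family_continuous (T : topologicalType) (i : T -> bool) (f : T -> R * X) :
  (forall x, \forall y \near x, i y = i x) -> continuous f ->
  continuous (fun x => H (i x) (f x)).
Proof.
move=> ci cf x B HB.
have nB : \forall y \near x, B (H (i x) (f y)).
  exact: (continuous_compose cf (@cH (i x)) HB).
suff : \forall y \near x, B (H (i y) (f y)) by [].
by apply: filterS2 (ci x) nB => y ->.
Qed.

Lemma motion_planner (U : set (X * Y)) (i j : X * Y -> bool) :
  (forall z, U z -> \forall z' \near z, i z' = i z) ->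
  (forall z, U z -> \forall z' \near z, j z' = j z) ->
  (forall z t, U z -> 1 <= t -> H (i z) (t, z.1) = b) ->
  (forall z t, U z -> 1 <= t -> H (j z) (t, set_val z.2) = b) ->
  exists s : U -> path_space R Y,
    continuous s /\ forall x : U, path_ends R Y (s x) = set_val x.
Proof.
move=> ci cj Hi Hj.
have cval : continuous (set_val : U -> X * Y) by exact: initial_continuous.
pose T := (U * unit_interval R)%type.
pose time (ut : T) : R := set_val ut.2.
pose pt (ut : T) : X * Y := set_val ut.1.
have ctime : continuous time.
  apply: (@continuous_compose _ _ _ snd set_val); first by move=> z; exact: cvg_snd.
  exact: initial_continuous.
have cpt : continuous pt.
  by apply: (@continuous_compose _ _ _ fst set_val) => // z; exact: cvg_fst.
have cpt2 : continuous (fun ut => set_val (pt ut).2).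
  apply: (@continuous_compose _ _ _ (fun ut => (pt ut).2) set_val).
    by apply: continuous_compose cpt _ => z; exact: cvg_snd.
  exact: initial_continuous.
have cpt1 : continuous (fun ut => (pt ut).1).
  by apply: continuous_compose cpt _ => z; exact: cvg_fst.
have locally (k : X * Y -> bool) : (forall z, U z -> \forall z' \near z, k z' = k z) ->
    forall ut, \forall ut' \near ut, k (pt ut') = k (pt ut).
  move=> ck ut.
  exact: (cpt ut [set z | k z = k (pt ut)] (ck _ (set_mem (valP ut.1)))).
pose out (ut : T) := H (i (pt ut)) (2 * time ut, (pt ut).1).
pose back (ut : T) := H (j (pt ut)) (2 - 2 * time ut, set_val (pt ut).2).
have cout : continuous out.
  apply: bool_family_continuous; first exact: locally.
  apply: continuous_pairing; last exact: cpt1.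
  by apply: continuous_mul => //; exact: cst_continuous.
have cback : continuous back.
  apply: bool_family_continuous; first exact: locally.
  apply: continuous_pairing; last exact: cpt2.
  apply: continuous_sub; first exact: cst_continuous.
  by apply: continuous_mul => //; exact: cst_continuous.
pose K (ut : T) := if time ut <= 1 / 2 then out ut else back ut.
have cK : continuous K.
  apply: continuous_pasting => // ut tE; rewrite /out /back tE Hi ?Hj//.
  - exact: set_mem (valP ut.1).
  - lra.
  - exact: set_mem (valP ut.1).
  - lra.
have [ccK cKu] := continuous_curry cK.
have K0 u : K (u, itv_zero R) = (set_val u).1.
  by rewrite /K /time /= divr_ge0// /out /time /= mulr0 H0.
have K1 u : K (u, itv_one R) = set_val (set_val u).2.
  have half1 : 1 / 2 < 1 :> R by lra.
  rewrite /K (_ : time _ = 1)// leNgt half1 /= /back (_ : time _ = 1)//.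
  by rewrite mulr1 subrr H0.
have Kpath u : (curry K u : {compact-open, unit_interval R -> X}) \in path_space R Y.
  apply/mem_set; split; first exact: cKu.
  by rewrite /curry K1; exact: set_mem (valP (set_val u).2).
exists (fun u => exist (fun g => g \in path_space R Y) (curry K u) (Kpath u)); split.
  exact: continuous_comp_initial.
move=> u; rewrite [RHS]surjective_pairing; congr pair; first exact: K0.
by apply: val_inj; exact: K1.
Qed.

End motion_planner.

(** * Deformations of a wedge of spheres *)

(** Pulling the points of a sphere along the chord to [q], with a weight that
vanishes at the antipode of [q]: then no chord passes through the centre. *)
Section sphere_pull.
Variables (R : realType) (d : nat) (q : sphere R d) (mu : sphere R d -> R).
Hypothesis cmu : continuous mu.
Hypothesis mu_antipode : forall y, set_val y = - set_val q -> mu y <= 0.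

Definition unit_clamp (t : R) : R := set_val (clamp t).

Lemma unit_clamp_continuous : continuous unit_clamp.
Proof.
apply: (@continuous_compose _ _ _ (@clamp R) set_val); first exact: clamp_continuous.
exact: initial_continuous.
Qed.

Definition pull_weight (ty : R * sphere R d) : R :=
  unit_clamp ty.1 * unit_clamp (mu ty.2).

Definition pull_segment (ty : R * sphere R d) : 'rV[R]_d.+1 :=
  (1 - pull_weight ty) *: set_val ty.2 + pull_weight ty *: set_val q.

Definition sphere_pull ty := direction (pull_segment ty).

Lemma pull_weight_continuous : continuous pull_weight.
Proof.
apply: continuous_mul.
  by apply: continuous_compose unit_clamp_continuous => z; exact: cvg_fst.
apply: (@continuous_compose _ _ _ (fun ty => mu ty.2)); last exact: unit_clamp_continuous.
by apply: continuous_compose cmu => z; exact: cvg_snd.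
Qed.

Lemma pull_segment_continuous : continuous pull_segment.
Proof.
apply: continuous_mx => i j; under eq_fun do rewrite !mxE.
have cw := pull_weight_continuous.
have c1w : continuous (fun ty => 1 - pull_weight ty).
  by apply: continuous_sub => //; exact: cst_continuous.
have cy : continuous (fun ty : R * sphere R d => set_val ty.2 i j).
  apply: (@continuous_compose _ _ _ (fun ty => set_val ty.2) (fun u : 'rV[R]_d.+1 => u i j)).
    apply: (@continuous_compose _ _ _ snd set_val) => [z|]; first exact: cvg_snd.
    exact: initial_continuous.
  exact: coord_continuous.
have c1 := continuous_mul c1w cy.
have c2 : continuous (fun ty => pull_weight ty * set_val q i j).
  by apply: continuous_mul => //; exact: cst_continuous.
exact: continuous_add c1 c2.
Qed.

Lemma pull_segment_neq0 ty : pull_segment ty != 0.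
Proof.
apply/eqP; rewrite /pull_segment; set w := pull_weight ty => /eqP.
rewrite addr_eq0 => /eqP yq.
have half_neq0 : 1 / 2 != 0 :> R by apply: lt0r_neq0; lra.
(* Opposite vectors have equal norms. *)
have w12 : w = 1 / 2.
  have := congr1 (@sqnorm R d) yq; rewrite sqnormN !sqnormZ !sqnorm_val !mulr1.
  by move=> /eqP; rewrite eqf_sqr => /orP[]/eqP; lra.
have y_q : set_val ty.2 = - set_val q.
  apply: (@scalerI _ _ (1 / 2)); first exact: half_neq0.
  by move: yq; rewrite w12 (_ : 1 - 1 / 2 = 1 / 2 :> R) ?scalerN//; lra.
have : w = 0.
  by rewrite /w /pull_weight /unit_clamp [X in _ * set_val X]clamp_le0 ?mulr0 ?mu_antipode.
by rewrite w12; exact/eqP.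
Qed.

Lemma sphere_pull_continuous : continuous sphere_pull.
Proof.
move=> ty; apply: continuous_comp; first exact: pull_segment_continuous.
by apply: direction_continuous; exact: pull_segment_neq0.
Qed.

Lemma sphere_pull_weight0 t y : (t <= 0) || (mu y <= 0) -> sphere_pull (t, y) = y.
Proof.
move=> tmu; rewrite /sphere_pull /pull_segment (_ : pull_weight _ = 0).
  by rewrite subr0 scale1r scale0r addr0 direction_id.
by rewrite /pull_weight /unit_clamp; case/orP: tmu => /clamp_le0 /= ->; rewrite ?mul0r ?mulr0.
Qed.

Lemma sphere_pull_weight1 t y : 1 <= t -> 1 <= mu y -> sphere_pull (t, y) = q.
Proof.
move=> t1 mu1; rewrite /sphere_pull /pull_segment (_ : pull_weight _ = 1).
  by rewrite subrr scale0r scale1r add0r direction_id.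
by rewrite /pull_weight /unit_clamp /= !clamp_ge1//= mulr1.
Qed.

Lemma sphere_pull_center t : sphere_pull (t, q) = q.
Proof.
by rewrite /sphere_pull /pull_segment -scalerDl subrK scale1r direction_id.
Qed.

End sphere_pull.

Section wedge_contractions.
Variables (R : realType) (n : nat) (a : 'I_n -> nat).
Hypothesis a_gt0 : forall i, (0 < a i)%N.
Local Notation W := (sphere_wedge R a).
Local Notation base := (fun i : 'I_n => sphere_pt R (a i)).
Implicit Types i : 'I_n.

Lemma wedge_lift_base i1 i2 :
  wedge_lift base (base i1) = wedge_lift base (base i2).
Proof. exact: (wedge_liftE base (base i2) (base i1)). Qed.

Definition wedge_homotopy (k : forall i, R * sphere R (a i) -> sphere R (a i))
    (tx : R * W) : W :=
  wedge_fun (fun i y => wedge_lift base (k i (tx.1, y))) tx.2.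

Section wedge_homotopy_theory.
Variable k : forall i, R * sphere R (a i) -> sphere R (a i).
Hypothesis k_base : forall i t, k (t, base i) = base i.

Lemma wedge_homotopy_lift t i (y : sphere R (a i)) :
  wedge_homotopy k (t, wedge_lift base y) = wedge_lift base (k (t, y)).
Proof.
rewrite /wedge_homotopy /= wedge_lift_funE// => i1 i2; rewrite !k_base.
exact: wedge_lift_base.
Qed.

Lemma wedge_homotopy_continuous :
  (forall i, continuous (@k i)) -> continuous (wedge_homotopy k).
Proof.
move=> ck.
have -> : wedge_homotopy k = uncurry
    (fun t => wedge_fun (fun i y => wedge_lift base (k (t, y)))).
  by apply/funext => -[].
apply: (@wedge_fun_joint_continuous _ _ base R W
  (fun i t y => wedge_lift base (k (t, y)))).
- exact: finite_finset.
- move=> i; apply/accessible_closed_set1/hausdorff_accessible.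
  exact/set_type_hausdorff/norm_hausdorff.
- by move=> t i1 i2; rewrite !k_base; exact: wedge_lift_base.
- move=> i.
  have -> : uncurry (fun t y => wedge_lift base (k (t, y))) = @wedge_lift _ _ base i \o @k i.
    by apply/funext => -[].
  by move=> z; apply: continuous_comp; [exact: ck|exact: wedge_lift_continuous].
Qed.

End wedge_homotopy_theory.

Definition wedge_height : W -> R := wedge_fun (fun i (y : sphere R (a i)) => set_val y 0 0).

Let base_height i : set_val (base i) 0 0 = 1.
Proof. by rewrite /= mxE !eqxx. Qed.

Lemma wedge_height_lift i (y : sphere R (a i)) :
  wedge_height (wedge_lift base y) = set_val y 0 0.
Proof. by rewrite /wedge_height wedge_lift_funE// => i1 i2; rewrite !base_height. Qed.

Let height_continuous d : continuous (fun y : sphere R d => set_val y 0 0).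
Proof.
apply: (@continuous_compose _ _ _ set_val (fun u : 'rV[R]_d.+1 => u 0 0)).
  exact: initial_continuous.
exact: coord_continuous.
Qed.

Lemma wedge_height_continuous : continuous wedge_height.
Proof.
apply: wedge_fun_continuous => [i|i1 i2]; first exact: height_continuous.
by rewrite !base_height.
Qed.

(* The second basis vector, which exists because the dimension is positive. *)
Let equator_sub d : (0 < d)%N -> delta_mx 0 (inord 1) \in sphere R d.
Proof.
move=> d0; rewrite inE /sphere /= (bigD1 (inord 1))//= mxE !eqxx expr1n.
by rewrite big1 ?addr0// => i /negbTE i1; rewrite mxE i1 andbF expr0n.
Qed.

Let equator i : sphere R (a i) := exist _ (delta_mx 0 (inord 1)) (equator_sub (a_gt0 i)).

Let equator_height i : set_val (equator i) 0 0 = 0.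
Proof.
rewrite /= mxE eqxx /= -val_eqE /= inordK; last by rewrite ltnS a_gt0.
by [].
Qed.

(* The weights are clamped to the unit interval: [down_weight] reaches 1 at
   height -1/3 and 0 at the antipode of the base point, [up_weight] is 0 from
   the equator up and 1 from height -1/6 down. *)
Let down_weight i (y : sphere R (a i)) : R := 3 / 2 * (1 + set_val y 0 0).
Let up_weight i (y : sphere R (a i)) : R := - 6 * set_val y 0 0.

Let to_base i := sphere_pull (base i) (@down_weight i).
Let to_equator i := sphere_pull (equator i) (@up_weight i).

Let down_continuous i : continuous (@down_weight i).
Proof.
apply: continuous_mul; first exact: cst_continuous.
by apply: continuous_add; [exact: cst_continuous|exact: height_continuous].
Qed.

Let up_continuous i : continuous (@up_weight i).
Proof. by apply: continuous_mul; [exact: cst_continuous|exact: height_continuous]. Qed.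

Let down_antipode i y : set_val y = - set_val (base i) -> down_weight y <= 0.
Proof. by move=> yE; rewrite /down_weight yE mxE base_height; lra. Qed.

Let up_antipode i y : set_val y = - set_val (equator i) -> up_weight y <= 0.
Proof. by move=> yE; rewrite /up_weight yE mxE equator_height; lra. Qed.

Let to_base_base i t : to_base (t, base i) = base i.
Proof. exact: sphere_pull_center. Qed.

Let to_equator_base i t : to_equator (t, base i) = base i.
Proof.
by apply: sphere_pull_weight0; apply/orP; right; rewrite /up_weight base_height; lra.
Qed.

Let pull_base := wedge_homotopy to_base.
Let pull_equator := wedge_homotopy to_equator.

Let pull_base_continuous : continuous pull_base.
Proof.
apply: wedge_homotopy_continuous => // i.
exact: sphere_pull_continuous (@down_continuous i) (@down_antipode i).
Qed.

Let pull_equator_continuous : continuous pull_equator.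
Proof.
apply: wedge_homotopy_continuous => // i.
exact: sphere_pull_continuous (@up_continuous i) (@up_antipode i).
Qed.

Let wedge_liftP (x : W) : exists i (y : sphere R (a i)), x = wedge_lift base y.
Proof.
have : [set: W] x by []; rewrite -wedgeTE => -[i _ [y _ <-]].
by exists i, y.
Qed.

(** The pull to the base point does not bring the points of small height there.
These are first brought to a point of the equator, which it does bring there. *)
Definition wedge_contraction (low : bool) (tx : R * W) : W :=
  if low then pull_base (2 * tx.1 - 1, pull_equator (2 * tx.1, tx.2))
  else pull_base tx.

Lemma wedge_contraction_continuous low : continuous (wedge_contraction low).
Proof.
case: low; last exact: pull_base_continuous.
have c1 : continuous (fun tx : R * W => 2 * tx.1).
  by apply: continuous_mul; [exact: cst_continuous|move=> z; exact: cvg_fst].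
apply: (@continuous_compose _ _ _ (fun tx : R * W =>
  (2 * tx.1 - 1, pull_equator (2 * tx.1, tx.2))) pull_base) => //.
apply: continuous_pairing; first by apply: continuous_sub => //; exact: cst_continuous.
apply: (@continuous_compose _ _ _ (fun tx : R * W => (2 * tx.1, tx.2))) => //.
by apply: continuous_pairing => // z; exact: cvg_snd.
Qed.

Lemma wedge_contraction0 low x t : t <= 0 -> wedge_contraction low (t, x) = x.
Proof.
have [i [y ->]] := wedge_liftP x => t0.
have pb s : s <= 0 -> pull_base (s, wedge_lift base y) = wedge_lift base y.
  by move=> s0; rewrite /pull_base wedge_homotopy_lift// /to_base sphere_pull_weight0 ?s0.
case: low => /=; last exact: pb.
rewrite /pull_equator wedge_homotopy_lift// /to_equator sphere_pull_weight0; last first.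
  by apply/orP; left; lra.
by apply: pb; lra.
Qed.

Lemma wedge_contraction1 low x t i : 1 <= t ->
  (if low then wedge_height x <= - (1 / 6) else - (1 / 3) <= wedge_height x) ->
  wedge_contraction low (t, x) = wedge_lift base (base i).
Proof.
have [k [y ->]] := wedge_liftP x => t1; rewrite wedge_height_lift => hy.
have pb s (z : sphere R (a k)) : 1 <= s -> - (1 / 3) <= set_val z 0 0 ->
    pull_base (s, wedge_lift base z) = wedge_lift base (base i).
  move=> s1 hz; rewrite /pull_base wedge_homotopy_lift// /to_base sphere_pull_weight1//.
    exact: wedge_lift_base.
  by rewrite /down_weight; lra.
case: low hy => /= hy; last exact: pb.
rewrite /pull_equator wedge_homotopy_lift// /to_equator sphere_pull_weight1.
- by apply: pb; [lra|rewrite equator_height; lra].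
- by lra.
- by rewrite /up_weight; lra.
Qed.

End wedge_contractions.

(** * Upper bounds for wedges of spheres *)

Section wedge_upper_bounds.
Variables (R : realType) (n : nat) (a : 'I_n -> nat).
Hypothesis n_gt0 : (0 < n)%N.
Hypothesis a_gt0 : forall i, (0 < a i)%N.
Local Notation W := (sphere_wedge R a).
Let height : W -> R := @wedge_height R n a.
Let base : W := wedge_lift (fun i => sphere_pt R (a i)) (sphere_pt R (a (Ordinal n_gt0))).

Let planner (Y : set W) := @motion_planner R W Y base (wedge_contraction a_gt0)
  (@wedge_contraction_continuous R n a a_gt0) (@wedge_contraction0 R n a a_gt0).

Let height1_continuous (Y : set W) : continuous (fun z : W * Y => height z.1).
Proof.
apply: (@continuous_compose _ _ _ fst height) => [z|]; first exact: cvg_fst.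
exact: wedge_height_continuous.
Qed.

Let height2_continuous (Y : set W) :
  continuous (fun z : W * Y => height (set_val z.2)).
Proof.
apply: (@continuous_compose _ _ _ (fun z : W * Y => set_val z.2) height).
  apply: (@continuous_compose _ _ _ snd set_val) => [z|]; first exact: cvg_snd.
  exact: initial_continuous.
exact: wedge_height_continuous.
Qed.

Let open_above (T : topologicalType) (f : T -> R) c :
  continuous f -> open [set x | c < f x].
Proof.
by move=> cf; apply: (@open_comp _ _ f [set x | c < x]) => [x _|]; [exact: cf|exact: open_gt].
Qed.

Let open_below (T : topologicalType) (f : T -> R) c :
  continuous f -> open [set x | f x < c].
Proof.
by move=> cf; apply: (@open_comp _ _ f [set x | x < c]) => [x _|]; [exact: cf|exact: open_lt].
Qed.

Lemma wedge_point_2cover (p : W) : has_sectional_cover (path_ends R [set p]) 2.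
Proof.
pose jp : bool := height p < - (1 / 4).
exists (fun i : 'I_2 => if i == ord0 then [set z | - (1 / 3) < height z.1]
  else [set z : W * [set p] | height z.1 < - (1 / 6)]); split.
- move=> i; case: ifP => _.
    exact: open_above (@height1_continuous _).
  exact: open_below (@height1_continuous _).
- rewrite -subTset => z _; have [h|h] := ltP (- (1 / 3)) (height z.1).
    by exists ord0.
  by exists ord_max => //=; lra.
- move=> i; apply: (@planner _ _ (fun=> i != ord0) (fun=> jp)).
  + by move=> z _; exact: filterE.
  + by move=> z _; exact: filterE.
  + move=> z t Uz t1; apply: wedge_contraction1 => //.
    by case: (i == ord0) Uz => /= /ltW.
  + move=> z t _ t1; apply: wedge_contraction1 => //.
    have -> : set_val z.2 = p by exact: set_mem (valP z.2).
    rewrite -/height /jp; case: ltP => h; lra.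
Qed.

Lemma wedge_3cover (Y : set W) : has_sectional_cover (path_ends R Y) 3.
Proof.
pose low (x : W) : bool := height x < - (1 / 4).
pose h1 (z : W * Y) := height z.1; pose h2 (z : W * Y) := height (set_val z.2).
(* Negative exactly where -1/4 separates the two heights. *)
pose mixed (z : W * Y) := (h1 z + 1 / 4) * (h2 z + 1 / 4).
have cmixed : continuous mixed.
  by apply: continuous_mul; apply: continuous_add;
    by [exact: height1_continuous|exact: height2_continuous|exact: cst_continuous].
pose U (i : 'I_3) : set (W * Y) :=
  if val i is 0%N then [set z | - (1 / 3) < h1 z] `&` [set z | - (1 / 3) < h2 z]
  else if val i is 1%N then [set z | h1 z < - (1 / 6)] `&` [set z | h2 z < - (1 / 6)]
  else [set z | mixed z < 0].
(* Where [mixed] is negative no height is -1/4, so the comparison of a height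
   with -1/4 is locally constant. *)
have near_low (f : W * Y -> R) z : continuous f -> mixed z < 0 ->
    (mixed z < 0 -> f z != - (1 / 4)) ->
    \forall z' \near z, (f z' < - (1 / 4)) = (f z < - (1 / 4)).
  move=> cf mz /(_ mz); rewrite neq_lt => /orP[fz|fz].
    have nz : \forall z' \near z, f z' < - (1 / 4).
      by apply: open_nbhs_nbhs; split; [exact: (@open_below _ f (- (1 / 4)) cf)|exact: fz].
    by apply: filterS nz => z' fz'; rewrite fz' fz.
  have nz : \forall z' \near z, - (1 / 4) < f z'.
    by apply: open_nbhs_nbhs; split; [exact: (@open_above _ f (- (1 / 4)) cf)|exact: fz].
  by apply: filterS nz => z' fz'; rewrite !ltNge !ltW.
exists U; split.
- case=> -[|[|[|//]]] ? /=.
  + by apply: openI; [exact: open_above (@height1_continuous _)|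
      exact: open_above (@height2_continuous _)].
  + by apply: openI; [exact: open_below (@height1_continuous _)|
      exact: open_below (@height2_continuous _)].
  + exact: open_below.
- rewrite -subTset => z _.
  have [x1|x1] := ltP (- (1 / 3)) (h1 z); have [y1|y1] := ltP (- (1 / 3)) (h2 z).
  + by exists (@Ordinal 3 0 isT).
  + have [x2|x2] := ltP (h1 z) (- (1 / 6)).
      by exists (@Ordinal 3 1 isT) => //; split => //=; lra.
    by exists (@Ordinal 3 2 isT) => //; rewrite /U /= /mixed; nra.
  + have [y2|y2] := ltP (h2 z) (- (1 / 6)).
      by exists (@Ordinal 3 1 isT) => //; split => //=; lra.
    by exists (@Ordinal 3 2 isT) => //; rewrite /U /= /mixed; nra.
  + by exists (@Ordinal 3 1 isT) => //; split => /=; lra.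
- case=> -[|[|[|//]]] i3; rewrite /U /=.
  + apply: (@planner _ _ (fun=> false) (fun=> false)).
    * by move=> z _; exact: filterE.
    * by move=> z _; exact: filterE.
    * by move=> z t [/ltW h _] t1; exact: wedge_contraction1.
    * by move=> z t [_ /ltW h] t1; exact: wedge_contraction1.
  + apply: (@planner _ _ (fun=> true) (fun=> true)).
    * by move=> z _; exact: filterE.
    * by move=> z _; exact: filterE.
    * by move=> z t [/ltW h _] t1; exact: wedge_contraction1.
    * by move=> z t [_ /ltW h] t1; exact: wedge_contraction1.
  + apply: (@planner _ _ (fun z => low z.1) (fun z => low (set_val z.2))).
    * move=> z mz; apply: (near_low h1) => // _.
      by apply: contraTneq mz; rewrite /mixed => ->; rewrite addNr mul0r ltxx.
    * move=> z mz; apply: (near_low h2) => // _.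
      by apply: contraTneq mz; rewrite /mixed => ->; rewrite addNr mulr0 ltxx.
    * move=> z t _ t1; apply: wedge_contraction1 => //.
      by rewrite -/height /low; case: ltP => h; lra.
    * move=> z t _ t1; apply: wedge_contraction1 => //.
      by rewrite -/height /low; case: ltP => h; lra.
Qed.

End wedge_upper_bounds.

Theorem proposition3p13 (R : realType) (n : nat) (a : 'I_n -> nat)
    (n_gt0 : (0 < n)%N) (a_gt0 : forall i : 'I_n, (0 < a i)%N) :
  (forall p : sphere_wedge R a, TC R [set p] = 2%N%:E) /\
  (forall m : nat, (1 < m < n)%N -> TC R (sphere_subwedge R a m) = 3%N%:E).
Proof.
split=> [p|m /andP[m1 mn]]; apply/genusP; split.
- exact: wedge_point_2cover.
- move=> l fl; rewrite leqNgt; apply/negP => l2.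
  exact: (wedge_point_not_1cover n_gt0 (has_sectional_cover_leq _ fl)).
- exact: wedge_3cover.
- move=> l fl; rewrite leqNgt; apply/negP => l3.
  apply: (@wedge_subwedge_not_2cover R n a m); last exact: has_sectional_cover_leq fl.
  by rewrite (ltnW m1).
Qed.
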